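(* Let $r\ge3$ be odd, $\zeta=e^{2\pi i/r}$, and let $\rho_1^{\mathfrak u_\zeta}(\tau_\beta):\mathrm{ad}\to\mathrm{ad}$ be the linear map $x\mapsto\lambda(v_{(2)}x)S(v_{(1)})$ giving the quantum action of the Dehn twist $\tau_\beta$, where $v$ is the ribbon element and $\lambda$ the left integral of $\mathfrak u_\zeta$. For all integers $0\le\ell,m,n\le r-1$, $$\rho_1^{\mathfrak u_\zeta}(\tau_\beta)\left(E^\ell T_mF^{(n)}\right)\propto\sum_{i,j=0}^{r-1}\begin{bmatrix}\ell\\i\end{bmatrix}_\zeta\zeta^{-\frac{i(i-5)}2-2j(j-1)-2ij+(\ell+2m-n)i+2\ell j}E^{\ell-i}T_{m+j}F^{(n-i)},$$ where $\propto$ means equality up to a nonzero complex scalar that does not depend on $\ell,m,n$.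
   Context: $\mathfrak u_\zeta$ is the $\mathbb C$-algebra with generators $E,F^{(1)},K$ and relations $E^r=(F^{(1)})^r=0$, $K^r=1$, $KEK^{-1}=\zeta^2E$, $KF^{(1)}K^{-1}=\zeta^{-2}F^{(1)}$, $[E,F^{(1)}]=K-K^{-1}$, with $\Delta(E)=E\otimes K+1\otimes E$, $\Delta(F^{(1)})=K^{-1}\otimes F^{(1)}+F^{(1)}\otimes1$, $\Delta(K)=K\otimes K$, $S(E)=-EK^{-1}$, $S(F^{(1)})=-KF^{(1)}$, $S(K)=K^{-1}$; Sweedler notation $\Delta(x)=x_{(1)}\otimes x_{(2)}$. $[n]_\zeta=\frac{\zeta^n-\zeta^{-n}}{\zeta-\zeta^{-1}}$; quantum binomials $\begin{bmatrix}k\\\ell\end{bmatrix}_\zeta=\frac{[k]_\zeta!}{[\ell]_\zeta![k-\ell]_\zeta!}$, zero if $\ell>k$. $F^{(a)}=(F^{(1)})^a/[a]_\zeta!$ for $0\le a\le r-1$, and $F^{(a)}=0$ for $a<0$; $T_a=\frac1r\sum_{b=0}^{r-1}\zeta^{2ab}K^b$ (index mod $r$). $\mathrm{ad}$ has underlying vector space $\mathfrak u_\zeta$. R-matrix $R=R'_i\otimes R''_i=\sum_{a,b=0}^{r-1}\zeta^{a(a-1)/2}K^{-b}E^a\otimes T_bF^{(a)}$, $u=S(R''_i)R'_i$, $v=uK^{-1}$. Left integral: $\lambda(E^aF^{(b)}T_c)=\frac{\zeta^{-2c}}{\sqrt r}\delta_{a,r-1}\delta_{b,r-1}$ for $0\le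 a,b,c\le r-1$. *)

(* Defs.v *)
From HB Require Import structures.
From mathcomp Require Import all_boot all_order all_algebra.
From mathcomp Require Import complex reals trigo.
Set Implicit Arguments.
Unset Strict Implicit.
Unset Printing Implicit Defensive.
Import Order.TTheory GRing.Theory Num.Theory.
Local Open Scope ring_scope.
Local Open Scope complex_scope.

Section QuantumNumbers.
Variables (R : realType) (r : nat).

(* exp (2 i pi / r) *)
Definition zeta : R[i] :=
  (cos (2 * pi / r%:R) : R) +i* (sin (2 * pi / r%:R) : R).

Definition qint (n : nat) : R[i] := (zeta ^+ n - zeta ^- n) / (zeta - zeta^-1).

Definition qfact (n : nat) : R[i] := \prod_(1 <= k < n.+1) qint k.

Definition qbinom (k l : nat) : R[i] :=
  if (l <= k)%N then qfact k / (qfact l * qfact (k - l)) else 0.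

(* K^-1 is written K ^+ r.-1, which is legitimate since K ^+ r = 1. *)
Definition uzeta_relations (B : algType R[i]) (E F K : B) : Prop :=
  [/\ E ^+ r = 0 /\ F ^+ r = 0, K ^+ r = 1,
      K * E * K ^+ r.-1 = zeta ^+ 2 *: E,
      K * F * K ^+ r.-1 = zeta ^- 2 *: F &
      E * F - F * E = K - K ^+ r.-1].

(* An algebra presented by the generators E, F, K and the relations above, i.e.
   universal among the algebras with three elements satisfying them. *)
Record uzeta_presentation := UzetaPresentation {
  uz_alg :> algType R[i];
  uz_E : uz_alg;
  uz_F : uz_alg;
  uz_K : uz_alg;
  uz_rel : uzeta_relations uz_E uz_F uz_K;
  uz_exists : forall (B : algType R[i]) (e f k : B), uzeta_relations e f k ->
    exists phi : {lrmorphism uz_alg -> B},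
      [/\ phi uz_E = e, phi uz_F = f & phi uz_K = k];
  uz_unique : forall (B : algType R[i]) (phi psi : {lrmorphism uz_alg -> B}),
    phi uz_E = psi uz_E -> phi uz_F = psi uz_F -> phi uz_K = psi uz_K ->
    phi =1 psi
}.

End QuantumNumbers.

(* The tensor product algebra A (x) A over C, by its universal property. *)
Record tensor_square (C : fieldType) (A : algType C) := TensorSquare {
  ts_alg :> algType C;
  ts_pure : {bilinear A -> A -> ts_alg};
  ts_lift : forall V : lmodType C,
    {bilinear A -> A -> V} -> {linear ts_alg -> V};
  ts_liftE : forall (V : lmodType C) (f : {bilinear A -> A -> V}) (a b : A),
    ts_lift f (ts_pure a b) = f a b;
  ts_unique : forall (V : lmodType C) (f g : {linear ts_alg -> V}),
    (forall a b : A, f (ts_pure a b) = g (ts_pure a b)) -> f =1 g;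
  ts_one : ts_pure 1 1 = 1;
  ts_mul : forall a b c d : A,
    ts_pure a b * ts_pure c d = ts_pure (a * c) (b * d)
}.

Section Contractions.
Variables (C : fieldType) (A : algType C).
Variables (S : {linear A -> A}) (lam : {scalar A}) (x : A).

Definition drinfeld_map (a b : A) : A := S b * a.

Definition integral_map (a b : A) : A := lam (b * x) *: S a.

Fact drinfeld_map_bilinear : bilinear_for *:%R *:%R drinfeld_map.
Proof.
split=> a c b d; rewrite /drinfeld_map /=.
- by rewrite mulrDr scalerAr.
- by rewrite linearP mulrDl scalerAl.
Qed.

Fact integral_map_bilinear : bilinear_for *:%R *:%R integral_map.
Proof.
split=> a c b d; rewrite /integral_map /=.
- by rewrite linearP scalerDr !scalerA mulrC.
- by rewrite mulrDl -scalerAl linearP scalerDl scalerA.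
Qed.

HB.instance Definition _ :=
  bilinear_isBilinear.Build C A A A _ _ drinfeld_map drinfeld_map_bilinear.
HB.instance Definition _ :=
  bilinear_isBilinear.Build C A A A _ _ integral_map integral_map_bilinear.

End Contractions.

Section SmallQuantumGroup.
Variables (R : realType) (r : nat) (U : uzeta_presentation R r).
Local Notation zeta := (zeta R r).
Local Notation E := (uz_E U).
Local Notation F := (uz_F U).
Local Notation K := (uz_K U).

Definition uz_Kinv : U := K ^+ r.-1.
Local Notation Kinv := uz_Kinv.

(* The divided power F^(a), with F^(a) = 0 for a < 0. *)
Definition uz_Fdiv (a : int) : U :=
  if a is Posz n then (qfact R r n)^-1 *: F ^+ n else 0.

Definition uz_T (a : nat) : U :=
  r%:R^-1 *: \sum_(b < r) zeta ^+ (2 * a * b) *: K ^+ b.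

Variable UU : tensor_square U.
Local Notation "a ⊗ b" := (ts_pure UU a b) (at level 40).

(* An algebra morphism is determined by its values on the generators. *)
Definition uz_is_comul (Delta : {lrmorphism U -> UU}) : Prop :=
  [/\ Delta E = E ⊗ K + 1 ⊗ E,
      Delta F = Kinv ⊗ F + F ⊗ 1 &
      Delta K = K ⊗ K].

(* Likewise for an algebra anti-morphism. *)
Definition uz_is_antipode (S : {linear U -> U}) : Prop :=
  [/\ S 1 = 1, forall x y : U, S (x * y) = S y * S x,
      S E = - (E * Kinv), S F = - (K * F) & S K = Kinv].

Definition uz_is_left_integral (lam : {scalar U}) : Prop :=
  forall a b c : nat, (a < r)%N -> (b < r)%N -> (c < r)%N ->
    lam (E ^+ a * uz_Fdiv b * uz_T c) =
      if (a == r.-1) && (b == r.-1) then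
        zeta ^- (2 * c) / (Num.sqrt r%:R : R)%:C
      else 0.

(* 'C(a, 2) is a (a - 1) / 2. *)
Definition uz_Rmatrix : UU :=
  \sum_(a < r) \sum_(b < r)
    zeta ^+ 'C(a, 2) *: ((Kinv ^+ b * E ^+ a) ⊗ (uz_T b * uz_Fdiv a)).

(* u = S(R'') R' *)
Definition uz_drinfeld (S : {linear U -> U}) : U :=
  ts_lift UU (drinfeld_map S) uz_Rmatrix.

Definition uz_ribbon (S : {linear U -> U}) : U := uz_drinfeld S * Kinv.

(* x |-> lam (v_(2) x) S(v_(1)) *)
Definition rho_tau_beta (Delta : {lrmorphism U -> UU}) (S : {linear U -> U})
    (lam : {scalar U}) (x : U) : U :=
  ts_lift UU (integral_map S lam x) (Delta (uz_ribbon S)).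

End SmallQuantumGroup.

(* Main.v *)
(* Explicitly, the ribbon element is
     v = sum_(a, b) (-1)^a zeta^(3 a (a - 1) / 2) K^a F^(a) T_(-b) K^(-b) E^a K^(-1).
   Invariance of lam, in the form x_(1) lam(x_(2)) = lam(x) 1, together with
   S(h_(1)) h_(2) = eps(h), gives
     lam(v_(2) x) S(v_(1)) = x_(1) lam(v x_(2)),
   so that only Delta(E^l T_m F^(n)), a q-binomial expansion, and the numbers
   lam(v E^i T_j F^(k)) are needed.  Since lam(y F) = zeta^2 lam(F y), the factor F^(a)
   of v can be moved to the far right; then lam selects a + i = a + k = r - 1, and the
   quantum binomial [r - 1, a] = (-1)^a cancels the sign of the remaining term of v.
   Matching with the stated sum is the substitution j -> -j modulo r. *)
Require Import Defs.
From HB Require Import structures.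
From mathcomp Require Import all_boot all_order all_algebra.
From mathcomp Require Import complex reals trigo.
From mathcomp Require Import ring lra zify.
Set Implicit Arguments.
Unset Strict Implicit.
Unset Printing Implicit Defensive.
Import Order.TTheory GRing.Theory Num.Theory.
Local Open Scope ring_scope.
Local Open Scope complex_scope.

(** * Sums of periodic functions over residues modulo r *)

Section PeriodicSums.
Variables (V : zmodType) (r : nat) (f : int -> V).
Hypothesis (r_gt0 : (0 < r)%N).
Hypothesis (f_periodic : forall x t : int, f (x + r%:Z * t) = f x).

Fact residue_subproof (x : int) : (`|(x %% r%:Z)%Z| < r)%N.
Proof.
have r0 : r%:Z != 0 by rewrite -lt0n.
by rewrite -ltz_nat gez0_abs ?modz_ge0 ?ltz_pmod.
Qed.

Definition residue (x : int) : 'I_r := Ordinal (residue_subproof x).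

Lemma residueE (x : int) : (residue x)%:Z = (x %% r%:Z)%Z.
Proof. by rewrite /= gez0_abs ?modz_ge0// -lt0n. Qed.

(** Exactly one b below r is congruent to x, and periodicity gives it the value at x. This collapses
    the sums left by products of the orthogonal idempotents [uz_Tz]. *)
Lemma sum_periodic_delta (x : int) :
  \sum_(b < r) (if (r%:Z %| b%:Z - x)%Z then f b%:Z else 0) = f x.
Proof.
rewrite (bigD1 (residue x)) //= big1 ?addr0 => [|b].
  rewrite -eqz_mod_dvd residueE modz_mod eqxx.
  by rewrite [in RHS](divz_eq x r%:Z) mulrC addrC f_periodic.
case: ifP => // + /eqP b_ne; rewrite -eqz_mod_dvd => /eqP b_x.
by case: b_ne; apply/val_inj/eqP; rewrite -eqz_nat residueE -b_x modz_small// ltz_nat ltn_ord.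
Qed.

Lemma sum_periodic_sub (x : int) : \sum_(j < r) f (x - j%:Z) = \sum_(j < r) f j%:Z.
Proof.
have res_inj : injective (fun j : 'I_r => residue (x - j%:Z)).
  (* The reflection j -> x - j modulo r is its own inverse. *)
  apply: (can_inj (g := fun j : 'I_r => residue (x - j%:Z))) => j.
  apply/val_inj/eqP; rewrite -eqz_nat residueE residueE.
  by rewrite -modzDmr modzNm modzDmr opprB addrC subrK modz_small// ltz_nat ltn_ord.
rewrite [RHS](reindex_inj res_inj) /=; apply: eq_bigr => j _.
by rewrite residueE [in LHS](divz_eq (x - j%:Z) r%:Z) mulrC addrC f_periodic.
Qed.

End PeriodicSums.

(** * Powers of the root of unity, quantum factorials and Gaussian binomials *)

Section RootOfUnity.
Variables (R : realType) (r : nat) (r_ge3 : (3 <= r)%N) (r_odd : odd r).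
Local Notation q := (zeta R r).

Let r_gt0 : (0 < r)%N. Proof. exact: ltn_trans r_ge3. Qed.

Lemma zeta_exp (n : nat) :
  q ^+ n = (cos (2 * pi / r%:R *+ n) : R) +i* (sin (2 * pi / r%:R *+ n) : R).
Proof.
elim: n => [|n IHn]; first by rewrite expr0 !mulr0n cos0 sin0.
rewrite exprS IHn (mulrS _ n) cosD sinD.
by apply/eqP; rewrite eq_complex /= eqxx addrC eqxx.
Qed.

(** So [q] is a primitive r-th root of unity. For m = n mod r nonzero, cos (2 pi m / r) = 1 would
    force sin (pi m / r) = 0 by the double angle formula, although 0 < pi m / r < pi. *)
Lemma zeta_exp_eq1 (n : nat) : (q ^+ n == 1) = (r %| n)%N.
Proof.
have r0 : r%:R != 0 :> R by rewrite pnatr_eq0 -lt0n.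
have q_r : q ^+ r = 1.
  rewrite zeta_exp -mulr_natr divfK// mulr_natl cos2pi sin2pi.
  by apply/eqP; rewrite eq_complex /= !eqxx.
have [/dvdnP[k ->]|ndvd] := boolP (r %| n)%N.
  by rewrite mulnC exprM q_r expr1n eqxx.
apply/negP; rewrite (divn_eq n r) exprD mulnC exprM q_r expr1n mul1r zeta_exp.
rewrite eq_complex /= => /andP[/eqP cos1 _].
have m_lt : (n %% r < r)%N by rewrite ltn_mod.
have m_gt0 : (0 < n %% r)%N by rewrite lt0n.
set m := (n %% r)%N in cos1 m_lt m_gt0.
have := cos_mulr2n (pi / r%:R *+ m : R).
have -> : (pi / r%:R *+ m) *+ 2 = 2 * pi / r%:R *+ m :> R.
  by rewrite mulrnAC -mulrA mulr_natl.
rewrite cos1 cos2sin2 => eq1.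
have : 0 < sin (pi / r%:R *+ m : R).
  apply: sin_gt0_pi; rewrite -mulr_natr; apply/andP; split.
    by rewrite !mulr_gt0 ?pi_gt0 ?invr_gt0 ?ltr0n.
  by rewrite mulrAC ltr_pdivrMr ?ltr0n// ltr_pM2l ?pi_gt0// ltr_nat.
by move=> /(exprn_gt0 2); lra.
Qed.

Lemma zeta_neq0 : q != 0.
Proof.
apply/eqP => q0; have : q ^+ r == 1 by rewrite zeta_exp_eq1 dvdnn.
by rewrite q0 expr0n gtn_eqF// eq_sym oner_eq0.
Qed.
Hint Resolve zeta_neq0 : core.

Lemma zetaD (x y : int) : q ^ (x + y) = q ^ x * q ^ y.
Proof. exact: expfzDr. Qed.

Lemma zetaz_eq1 (x : int) : (q ^ x == 1) = (r%:Z %| x)%Z.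
Proof.
case: x => n; first by rewrite zeta_exp_eq1.
by rewrite NegzE -exprnN invr_eq1 zeta_exp_eq1 dvdzE ?abszN.
Qed.

(* Doubling the exponents absorbs the halves in i (i - 5) / 2 and 'C(a, 2). *)
Lemma zeta_congr (t x y : int) : 2 * x - 2 * y = r%:Z * t -> q ^ x = q ^ y.
Proof.
move=> xy; apply/eqP; rewrite -[x](subrK y) zetaD -subr_eq0 -{2}[q ^ y]mul1r -mulrBl mulf_eq0.
rewrite subr_eq0 zetaz_eq1; apply/orP; left.
have : (r%:Z %| 2 * (x - y))%Z by apply/dvdzP; exists t; rewrite mulrBr xy mulrC.
by rewrite Gauss_dvdzr// coprimezE /= coprimen2.
Qed.

(** Orthogonality of the characters of Z/r: off the multiples of r, q^(2x) differs from 1 because r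
    is odd, and the geometric sum vanishes. *)
Lemma sum_zeta (x : int) :
  \sum_(j < r) q ^ (2 * j%:Z * x) = if (r%:Z %| x)%Z then r%:R else 0.
Proof.
have [/dvdzP[t ->]|ndvd] := boolP (_ %| _)%Z.
  rewrite (eq_bigr (fun=> 1)) => [|j _]; first by rewrite sumr_const card_ord.
  by rewrite -(expr0z q); apply: (zeta_congr (t := 4 * j%:Z * t)); ring.
have q2x : q ^ (2 * x) != 1.
  apply: contra ndvd => /eqP q2x; rewrite -zetaz_eq1 -q2x; apply/eqP.
  by move: q2x => /eqP; rewrite zetaz_eq1 => /dvdzP[t] e;
     apply: (zeta_congr (t := - t)); lia.
have := subrX1 (q ^ (2 * x)) r.
have -> : (q ^ (2 * x)) ^+ r = 1.
  by rewrite exprnP exprz_exp -(expr0z q); apply: (zeta_congr (t := 4 * x)); ring.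
rewrite subrr => /esym/eqP; rewrite mulf_eq0 subr_eq0 (negbTE q2x) /= => /eqP e.
by rewrite -[RHS]e; apply: eq_bigr => j _; rewrite exprnP exprz_exp; congr (_ ^ _); ring.
Qed.

Lemma zeta_sub_neq0 (n : nat) : (0 < n < r)%N -> q ^+ n - q ^- n != 0.
Proof.
move=> /andP[n_gt0 n_lt]; rewrite subr_eq0; apply/eqP => e.
have : q ^+ (n * 2) == 1 by rewrite mulnC mul2n -addnn exprD {2}e divff ?expf_neq0.
rewrite zeta_exp_eq1 Gauss_dvdl ?coprimen2// => /dvdn_leq => /(_ n_gt0).
by rewrite leqNgt n_lt.
Qed.

Lemma qint_neq0 (n : nat) : (0 < n < r)%N -> qint R r n != 0.
Proof.
move=> n_bd; rewrite mulf_neq0 ?zeta_sub_neq0// invr_eq0 -[q]expr1 -[q in _ - q]expr1.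
by rewrite zeta_sub_neq0//= (leq_trans _ r_ge3).
Qed.

Lemma qint_compl (n : nat) : (n <= r)%N -> qint R r (r - n) = - qint R r n.
Proof.
move=> n_le; rewrite /qint -mulNr opprB; congr (_ / _).
rewrite !exprnN !exprnP -subzn//; congr (_ - _).
  by apply: (zeta_congr (t := 2)); ring.
by apply: (zeta_congr (t := - 2)); ring.
Qed.

Lemma qfact0 : qfact R r 0 = 1. Proof. by rewrite /qfact big_geq. Qed.

Lemma qfactS (n : nat) : qfact R r n.+1 = qint R r n.+1 * qfact R r n.
Proof. by rewrite /qfact big_nat_recr //= mulrC. Qed.

Lemma qfact_neq0 (n : nat) : (n < r)%N -> qfact R r n != 0.
Proof.
elim: n => [|n IHn] n_lt; first by rewrite qfact0 oner_eq0.
by rewrite qfactS mulf_neq0 ?qint_neq0// IHn// ltnW.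
Qed.

(** Applying [r - k] = - [k] to the top n factors of [r - 1]! produces the sign; equivalently, the
    quantum binomial of r - 1 over n is (-1)^n. *)
Lemma qfact_compl (n : nat) :
  (n < r)%N -> qfact R r r.-1 = (-1) ^+ n * (qfact R r n * qfact R r (r.-1 - n)).
Proof.
elim: n => [|n IHn] n_lt; first by rewrite qfact0 expr0 !mul1r subn0.
rewrite IHn ?(ltnW n_lt)//.
have -> : (r.-1 - n = (r.-1 - n.+1).+1)%N by lia.
rewrite !qfactS exprS; have -> : ((r.-1 - n.+1).+1 = r - n.+1)%N by lia.
by rewrite qint_compl// 1?ltnW//; ring.
Qed.

(** The two middle terms q^(2i - n - 1) of the numerators cancel. This splitting of [n + 1] is the
    source of the Pascal rule. *)
Lemma qint_pascal (n i : nat) : (i <= n.+1)%N ->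
  qint R r n.+1 = q ^ i%:Z * qint R r (n.+1 - i) + q ^ (i%:Z - n.+1%:Z) * qint R r i.
Proof.
move=> i_le; rewrite /qint !mulrA -mulrDl; congr (_ / _).
rewrite !exprnN !exprnP -subzn// !mulrBr -!zetaD.
have -> : i%:Z + (n.+1%:Z - i%:Z) = n.+1%:Z by ring.
have -> : i%:Z - n.+1%:Z + i%:Z = i%:Z - (n.+1%:Z - i%:Z) by ring.
have -> : i%:Z - n.+1%:Z - i%:Z = - n.+1%:Z by ring.
ring.
Qed.

(* [q ^ (i (n - i)) qbinom n i] is the Gaussian binomial in q^2. *)
Definition gbinom (n i : nat) : R[i] := q ^ (i%:Z * (n%:Z - i%:Z)) * qbinom R r n i.

Lemma gbinom0 (n : nat) : (n < r)%N -> gbinom n 0 = 1.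
Proof.
move=> n_lt; rewrite /gbinom /qbinom /= mul0r expr0z subn0 qfact0 !mul1r.
by rewrite divff ?qfact_neq0.
Qed.

Lemma gbinomn (n : nat) : (n < r)%N -> gbinom n n = 1.
Proof.
move=> n_lt; rewrite /gbinom /qbinom /= leqnn subrr mulr0 expr0z subnn qfact0 mulr1 mul1r.
by rewrite divff ?qfact_neq0.
Qed.

(** Pascal rule in the variable q^2. The bound on n keeps the factorials invertible; the boundary
    values are [gbinom0] and [gbinomn]. *)
Lemma gbinomS (n i : nat) : (n.+1 < r)%N -> (i < n)%N ->
  gbinom n.+1 i.+1 = q ^ (2 * i.+1%:Z) * gbinom n i.+1 + gbinom n i.
Proof.
move=> n_lt i_lt; rewrite /gbinom /qbinom ltnS (ltnW i_lt) i_lt.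
rewrite qfactS (@qint_pascal n i.+1) ?ltnS ?(ltnW i_lt)// subSS.
have -> : (n - i = (n - i.+1).+1)%N by lia.
have q1 := @qfact_neq0 (n - i.+1); have q2 := @qfact_neq0 i.
have q3 := @qint_neq0 (n - i.+1).+1; have q4 := @qint_neq0 i.+1.
rewrite !qfactS.
(* All powers of [q] are written through common factors, which can then be treated as independent
   variables by [field]. *)
have -> : q ^ (i.+1%:Z * (n.+1%:Z - i.+1%:Z)) =
    q ^ (2 * i.+1%:Z) * q ^ (i.+1%:Z * (n%:Z - i.+1%:Z)) * q ^ (- i.+1%:Z).
  by rewrite -!zetaD; congr (_ ^ _); lia.
have -> : q ^ (i%:Z * (n%:Z - i%:Z)) =
    q ^ (2 * i.+1%:Z) * q ^ (i.+1%:Z * (n%:Z - i.+1%:Z)) * q ^ (- i.+1%:Z) *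
    q ^ (i.+1%:Z - n.+1%:Z).
  by rewrite -!zetaD; congr (_ ^ _); lia.
rewrite -[q ^ (- i.+1%:Z)]invr_expz.
have qi : q ^ i.+1%:Z != 0 by rewrite expfz_neq0.
move: (q ^ (2 * i.+1%:Z)) (q ^ (i.+1%:Z * (n%:Z - i.+1%:Z))) (q ^ (i.+1%:Z - n.+1%:Z)) => a b c.
move: (q ^ i.+1%:Z) qi => d qi.
field.
by rewrite qi q1 ?q2 ?q3 ?q4; lia.
Qed.

End RootOfUnity.

(** * Linear maps out of the tensor square *)

Section TensorSquare.
Variables (C : fieldType) (A : algType C) (AA : tensor_square A).
Local Notation "a ⊗ b" := (ts_pure AA a b) (at level 40).

(** Uniqueness in the universal property for plain functions with a linearity proof, so that
    composites such as t -> S a * f t need no bundling. *)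
Lemma tensor_ext (V : lmodType C) (f g : AA -> V) : linear f -> linear g ->
  (forall a b : A, f (a ⊗ b) = g (a ⊗ b)) -> f =1 g.
Proof.
move=> f_lin g_lin fg.
pose fM := GRing.isLinear.Build C AA V *:%R f f_lin.
pose gM := GRing.isLinear.Build C AA V *:%R g g_lin.
pose fL : {linear AA -> V} := HB.pack f fM.
pose gL : {linear AA -> V} := HB.pack g gM.
exact: (@ts_unique C A AA V fL gL fg).
Qed.

Lemma tensorXn (a b : A) (n : nat) : (a ⊗ b) ^+ n = (a ^+ n) ⊗ (b ^+ n).
Proof. by elim: n => [|n IHn]; rewrite ?expr0 ?ts_one// !exprS IHn ts_mul. Qed.

Variables (S : {linear A -> A}) (lam : {scalar A}).
Hypothesis S_mul : forall x y : A, S (x * y) = S y * S x.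

(* Lifted to A (x) A and composed with Delta, this is x |-> x_(1) lam (h x_(2)). *)
Definition slice_map (h a b : A) : A := lam (h * b) *: a.

Fact slice_map_bilinear (h : A) : bilinear_for *:%R *:%R (slice_map h).
Proof.
split=> a c b d; rewrite /slice_map /=.
- by rewrite scalerDr !scalerA mulrC.
- by rewrite mulrDr -scalerAr linearP scalerDl scalerA.
Qed.

HB.instance Definition _ (h : A) :=
  bilinear_isBilinear.Build C A A A _ _ (slice_map h) (slice_map_bilinear h).

(** On pure tensors, the antimultiplicativity of [S] brings S a out on the left, and b is absorbed
    into x by associativity. *)
Lemma lift_integral_mulr (x a b : A) (t : AA) :
  ts_lift AA (integral_map S lam x) (t * (a ⊗ b)) =
  S a * ts_lift AA (integral_map S lam (b * x)) t.
Proof.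
apply: (tensor_ext (f := fun t => ts_lift AA (integral_map S lam x) (t * (a ⊗ b)))
  (g := fun t => S a * ts_lift AA (integral_map S lam (b * x)) t)) => [c u v|c u v|c d].
- by rewrite mulrDl -scalerAl linearP.
- by rewrite linearP mulrDr scalerAr.
- by rewrite ts_mul !ts_liftE /= /integral_map S_mul -scalerAr mulrA.
Qed.

Lemma lift_slice_mull (h a b : A) (t : AA) :
  ts_lift AA (slice_map h) ((a ⊗ b) * t) = a * ts_lift AA (slice_map (h * b)) t.
Proof.
apply: (tensor_ext (f := fun t => ts_lift AA (slice_map h) ((a ⊗ b) * t))
  (g := fun t => a * ts_lift AA (slice_map (h * b)) t)) => [c u v|c u v|c d].
- by rewrite mulrDr -scalerAr linearP.
- by rewrite linearP mulrDr scalerAr.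
- by rewrite ts_mul !ts_liftE /= /slice_map -scalerAr mulrA.
Qed.

Lemma lift_slice_lin (c : C) (h k : A) (t : AA) :
  ts_lift AA (slice_map (c *: h + k)) t =
  c *: ts_lift AA (slice_map h) t + ts_lift AA (slice_map k) t.
Proof.
apply: (tensor_ext (f := fun t => ts_lift AA (slice_map (c *: h + k)) t)
  (g := fun t => c *: ts_lift AA (slice_map h) t + ts_lift AA (slice_map k) t))
  => [d u v|d u v|a b].
- by rewrite linearP.
- by rewrite !linearP /= !scalerA addrACA (mulrC c).
- by rewrite !ts_liftE /= /slice_map mulrDl -scalerAl linearP scalerDl scalerA.
Qed.

End TensorSquare.

(** * The binomial theorem for q-commuting elements *)

Section QBinomialTheorem.
Variables (R : realType) (r : nat) (r_ge3 : (3 <= r)%N) (r_odd : odd r).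
Local Notation q := (zeta R r).

Lemma q_commuteXX (A : algType R[i]) (x y : A) (c : int) (m n : nat) : x * y = q ^ c *: (y * x) ->
  x ^+ m * y ^+ n = q ^ (c * m%:Z * n%:Z) *: (y ^+ n * x ^+ m).
Proof.
move=> xy.
have xyn : x * y ^+ n = q ^ (c * n%:Z) *: (y ^+ n * x).
  elim: n => [|n IHn]; first by rewrite mulr0 expr0z scale1r expr0 mulr1 mul1r.
  rewrite exprSr mulrA IHn -scalerAl -!mulrA xy -scalerAr scalerA -zetaD//.
  by congr (q ^ _ *: _); rewrite intS; ring.
elim: m => [|m IHm]; first by rewrite mulr0 mul0r expr0z scale1r expr0 mulr1 mul1r.
rewrite exprS -mulrA IHm -scalerAr [x * (_ * _)]mulrA xyn -scalerAl scalerA -zetaD//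
  -[_ * x * _]mulrA.
by congr (q ^ _ *: _); rewrite intS; ring.
Qed.

Variables (A : algType R[i]) (x y : A).
Hypothesis xy : x * y = q ^ 2 *: (y * x).

Lemma q_binomial (n : nat) : (n < r)%N ->
  (x + y) ^+ n = \sum_(i < n.+1) gbinom R r n i *: (y ^+ i * x ^+ (n - i)).
Proof.
elim: n => [|n IHn] n_lt.
  by rewrite big_ord1 gbinom0 ?scale1r ?expr0 ?mulr1//; lia.
rewrite exprS IHn 1?ltnW// mulrDl !mulr_sumr.
(* The pure powers of x and y are split off as the end terms of the expansion; the remaining terms
   pair up by the Pascal rule, x crossing y^i at the cost of q^(2i). *)
rewrite [X in X + _]big_ord_recl [X in _ + X]big_ord_recr /=.
rewrite [RHS]big_ord_recl [X in _ = _ + X]big_ord_recr /= !subn0 !subnn.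
rewrite !gbinom0 ?gbinomn//; [|lia|lia].
rewrite !scale1r !expr0 !mulr1 !mul1r -!exprS -!addrA; congr (_ + _).
rewrite addrA; congr (_ + _); rewrite -big_split /=; apply: eq_bigr => i _.
rewrite /bump /= add1n gbinomS// subSS scalerDl -!scalerAr.
have xyi := q_commuteXX 1 i.+1 xy; rewrite !expr1 mulr1 in xyi.
rewrite [x * (_ * _)]mulrA xyi [y * (_ * _)]mulrA -exprS -scalerAl -[_ * x * _]mulrA -exprS.
have -> : ((n - i.+1).+1 = n - i)%N by have := ltn_ord i; lia.
by rewrite scalerA [gbinom _ _ _ _ * _]mulrC.
Qed.

End QBinomialTheorem.

(** * Commutation rules and the idempotents of the Cartan part *)

Section SmallQuantumGroup.
Variables (R : realType) (r : nat) (r_ge3 : (3 <= r)%N) (r_odd : odd r).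
Variable U : uzeta_presentation R r.
Local Notation q := (zeta R r).
Local Notation E := (uz_E U).
Local Notation F := (uz_F U).
Local Notation K := (uz_K U).
Local Notation Kinv := (uz_Kinv U).

Let r_gt0 : (0 < r)%N. Proof. exact: ltn_trans r_ge3. Qed.

Let rC_neq0 : r%:R != 0 :> R[i]. Proof. by rewrite pnatr_eq0 -lt0n. Qed.

Lemma E_nilp (n : nat) : (r <= n)%N -> E ^+ n = 0.
Proof.
by case: (uz_rel U) => -[E0 _] _ _ _ _ /subnK <-; rewrite exprD E0 mulr0.
Qed.

Lemma F_nilp (n : nat) : (r <= n)%N -> F ^+ n = 0.
Proof.
by case: (uz_rel U) => -[_ F0] _ _ _ _ /subnK <-; rewrite exprD F0 mulr0.
Qed.

Lemma K_order : K ^+ r = 1. Proof. by case: (uz_rel U). Qed.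

Lemma KinvK : Kinv * K = 1. Proof. by rewrite /uz_Kinv -exprSr prednK// K_order. Qed.

Lemma KKinv : K * Kinv = 1. Proof. by rewrite /uz_Kinv -exprS prednK// K_order. Qed.

Lemma KinvX (n : nat) : Kinv ^+ n = K ^+ (r.-1 * n).
Proof. by rewrite exprM. Qed.

Lemma K_E : K * E = q ^ 2 *: (E * K).
Proof.
by case: (uz_rel U) => _ _ KE _ _; rewrite scalerAl -KE -/Kinv -[RHS]mulrA KinvK mulr1.
Qed.

Lemma K_F : K * F = q ^ (- 2) *: (F * K).
Proof.
by case: (uz_rel U) => _ _ _ KF _; rewrite scalerAl -KF -/Kinv -[RHS]mulrA KinvK mulr1.
Qed.

Lemma EF_commutator : E * F - F * E = K - Kinv. Proof. by case: (uz_rel U). Qed.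

Lemma KX_EX (m n : nat) : K ^+ m * E ^+ n = q ^ (2 * m%:Z * n%:Z) *: (E ^+ n * K ^+ m).
Proof. exact: q_commuteXX _ _ K_E. Qed.

Lemma KX_FX (m n : nat) : K ^+ m * F ^+ n = q ^ (- 2 * m%:Z * n%:Z) *: (F ^+ n * K ^+ m).
Proof. exact: q_commuteXX _ _ K_F. Qed.

(** An integer index allows the negative shifts that arise when T crosses a power of F; the value
    depends only on the class modulo r. *)
Definition uz_Tz (a : int) : U := r%:R^-1 *: \sum_(b < r) q ^ (2 * a * b%:Z) *: K ^+ b.
Local Notation Tz := uz_Tz.

Lemma uz_TE (a : nat) : uz_T U a = Tz a%:Z.
Proof.
by congr (_ *: _); apply: eq_bigr => b _; congr (_ *: _); rewrite -exprnP !PoszM.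
Qed.

Lemma Tz_congr (t a b : int) : a - b = r%:Z * t -> Tz a = Tz b.
Proof.
move=> ab; congr (_ *: _); apply: eq_bigr => c _; congr (_ *: _).
apply: (zeta_congr _ r_ge3 r_odd (t := 4 * t * c%:Z)).
by rewrite -[a](subrK b) ab; ring.
Qed.

(** T_a projects onto the eigenspace of K for q^(-2a): multiplication by K shifts the summation
    index, and the term b = r wraps around to b = 0. *)
Lemma KX_Tz (n : nat) (a : int) : K ^+ n * Tz a = q ^ (- 2 * a * n%:Z) *: Tz a.
Proof.
have K_Tz : K * Tz a = q ^ (- 2 * a) *: Tz a.
  rewrite /uz_Tz -scalerAr [RHS]scalerA [_ * r%:R^-1]mulrC -[RHS]scalerA; congr (_ *: _).
  pose g b : U := q ^ (2 * a * b%:Z) *: K ^+ b.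
  have sum_shift : \sum_(b < r) q ^ (2 * a * b%:Z) *: K ^+ b = \sum_(b < r) g b.+1.
    apply: (addIr (g r)); rewrite -(big_ord_recr r (fun b : 'I_r.+1 => g b)) /=.
    rewrite big_ord_recl /= addrC; congr (_ + _).
    rewrite /g K_order expr0; congr (_ *: _).
    by apply: (zeta_congr _ r_ge3 r_odd (t := - 4 * a)); ring.
  rewrite [in RHS]sum_shift mulr_sumr scaler_sumr; apply: eq_bigr => b _.
  rewrite /g -scalerAr -exprS scalerA -zetaD//; congr (q ^ _ *: _).
  by rewrite intS; ring.
elim: n => [|n IHn]; first by rewrite mulr0 expr0z scale1r expr0 mul1r.
rewrite exprS -mulrA IHn -scalerAr K_Tz scalerA -zetaD//.
by congr (q ^ _ *: _); rewrite intS; ring.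
Qed.

Lemma Tz_KX (n : nat) (a : int) : Tz a * K ^+ n = q ^ (- 2 * a * n%:Z) *: Tz a.
Proof.
rewrite -KX_Tz /uz_Tz -scalerAl -scalerAr; congr (_ *: _).
rewrite mulr_suml mulr_sumr; apply: eq_bigr => b _.
by rewrite -scalerAl -scalerAr -!exprD addnC.
Qed.

Lemma Tz_EX (a : int) (n : nat) : Tz a * E ^+ n = E ^+ n * Tz (a + n%:Z).
Proof.
rewrite /uz_Tz -scalerAl -scalerAr; congr (_ *: _).
rewrite mulr_suml mulr_sumr; apply: eq_bigr => b _.
rewrite -scalerAl -scalerAr KX_EX scalerA -zetaD//; congr (q ^ _ *: _); ring.
Qed.

Lemma Tz_FX (a : int) (n : nat) : Tz a * F ^+ n = F ^+ n * Tz (a - n%:Z).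
Proof.
rewrite /uz_Tz -scalerAl -scalerAr; congr (_ *: _).
rewrite mulr_suml mulr_sumr; apply: eq_bigr => b _.
rewrite -scalerAl -scalerAr KX_FX scalerA -zetaD//; congr (q ^ _ *: _); ring.
Qed.

(** K acts on T_c by a scalar, so T_a acts on it by a character sum: the T_a are orthogonal
    idempotents. *)
Lemma Tz_Tz (a c : int) : Tz a * Tz c = if (r%:Z %| a - c)%Z then Tz c else 0.
Proof.
rewrite {1}/uz_Tz -scalerAl mulr_suml.
rewrite (eq_bigr (fun b : 'I_r => q ^ (2 * b%:Z * (a - c)) *: Tz c)) => [|b _]; last first.
  by rewrite -scalerAl KX_Tz scalerA -zetaD//; congr (q ^ _ *: _); ring.
rewrite -scaler_suml scalerA sum_zeta//; case: ifP => _; first by rewrite mulVf// scale1r.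
by rewrite mulr0 scale0r.
Qed.

(** Fourier inversion on the cyclic group generated by K. *)
Lemma KX_sum (b : nat) : (b < r)%N -> K ^+ b = \sum_(j < r) q ^ (- 2 * j%:Z * b%:Z) *: Tz j%:Z.
Proof.
move=> b_lt; rewrite /uz_Tz.
rewrite (eq_bigr (fun j : 'I_r =>
    r%:R^-1 *: \sum_(b' < r) q ^ (2 * j%:Z * (b'%:Z - b%:Z)) *: K ^+ b')); last first.
  move=> j _; rewrite scalerA [_ * r%:R^-1]mulrC -scalerA scaler_sumr; congr (_ *: _).
  by apply: eq_bigr => b' _; rewrite scalerA -zetaD//; congr (q ^ _ *: _); ring.
rewrite -scaler_sumr exchange_big /=.
rewrite (eq_bigr (fun b' : 'I_r => if b' == Ordinal b_lt then r%:R *: K ^+ b else 0)).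
  by rewrite -big_mkcond big_pred1_eq scalerA mulVf// scale1r.
move=> b' _; rewrite -scaler_suml sum_zeta// -val_eqE /=.
rewrite -eqz_mod_dvd !modz_small ?ltz_nat ?ltn_ord// eqz_nat.
by case: eqP => [->|_]//; rewrite scale0r.
Qed.

Lemma sum_Tz : \sum_(j < r) Tz j%:Z = 1.
Proof.
rewrite -(expr0 K) KX_sum//; apply: eq_bigr => j _.
by rewrite mulr0 expr0z scale1r.
Qed.

Lemma Tz_periodic (x t : int) : Tz (x + r%:Z * t) = Tz x.
Proof. by apply: (Tz_congr (t := t)); ring. Qed.

(** * Monomials in the order E, T, F and their linear span *)

Definition pbw_mono (a : nat) (c : int) (b : nat) : U := E ^+ a * Tz c * F ^+ b.
Local Notation mono := pbw_mono.

Lemma monoE (a b : nat) (c : int) : mono a c b = E ^+ a * (Tz c * F ^+ b).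
Proof. by rewrite mulrA. Qed.

Lemma KX_mono (n a b : nat) (c : int) :
  K ^+ n * mono a c b = q ^ (n%:Z * (2 * a%:Z - 2 * c)) *: mono a c b.
Proof.
rewrite /pbw_mono !mulrA KX_EX -!scalerAl -[E ^+ a * K ^+ n * _]mulrA KX_Tz -scalerAr -scalerAl.
by rewrite scalerA -zetaD//; congr (q ^ _ *: _); ring.
Qed.

Lemma mono_KX (n a b : nat) (c : int) :
  mono a c b * K ^+ n = q ^ (n%:Z * (2 * b%:Z - 2 * c)) *: mono a c b.
Proof.
have -> : mono a c b * K ^+ n = q ^ (2 * n%:Z * b%:Z) *: (E ^+ a * (Tz c * K ^+ n) * F ^+ b).
  rewrite /pbw_mono -!mulrA KX_FX -!scalerAr scalerA -zetaD//.
  by rewrite (_ : _ + _ = 0) ?expr0z ?scale1r//; ring.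
rewrite Tz_KX -scalerAr -scalerAl scalerA -zetaD//; congr (q ^ _ *: _); ring.
Qed.

(** An inductive predicate, so that identities linear in x reduce to monomials by elimination. Its
    closure under left multiplication by the generators is shown below. *)
Inductive pbw_span : U -> Prop :=
| pbw_span_base a c b : pbw_span (mono a c b)
| pbw_span_add x y : pbw_span x -> pbw_span y -> pbw_span (x + y)
| pbw_span_scale (c : R[i]) x : pbw_span x -> pbw_span (c *: x).

Lemma pbw_span_KX (n : nat) (x : U) : pbw_span x -> pbw_span (K ^+ n * x).
Proof.
elim=> [a c b|y z _ yS _ zS|c y _ yS].
- by rewrite KX_mono; apply/pbw_span_scale/pbw_span_base.
- by rewrite mulrDr; apply: pbw_span_add.
- by rewrite -scalerAr; apply: pbw_span_scale.
Qed.

Lemma pbw_span_EX (n : nat) (x : U) : pbw_span x -> pbw_span (E ^+ n * x).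
Proof.
elim=> [a c b|y z _ yS _ zS|c y _ yS].
- by rewrite /pbw_mono !mulrA -exprD; apply/pbw_span_base.
- by rewrite mulrDr; apply: pbw_span_add.
- by rewrite -scalerAr; apply: pbw_span_scale.
Qed.

Lemma F_ES (a : nat) : F * E ^+ a.+1 = E * (F * E ^+ a) - (K ^+ 1 - K ^+ r.-1) * E ^+ a.
Proof. by rewrite expr1 -EF_commutator exprS mulrBl !mulrA opprB addrCA subrr addr0. Qed.

Lemma F_Tz_FX (c : int) (b : nat) : F * (Tz c * F ^+ b) = Tz (c + 1) * F ^+ b.+1.
Proof.
by rewrite exprS !mulrA -[in RHS](expr1 F) Tz_FX expr1 addrK.
Qed.

Lemma pbw_span_F (x : U) : pbw_span x -> pbw_span (F * x).
Proof.
elim=> [a c b|y z _ yS _ zS|c y _ yS].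
(* F crosses one E at a time; each crossing leaves a term in K - K^-1, which acts on a monomial by a
   scalar. *)
- rewrite monoE; elim: a => [|a IHa].
    by rewrite mul1r F_Tz_FX -[_ * _]mul1r -(expr0 E) -monoE; apply: pbw_span_base.
  have -> : F * (E ^+ a.+1 * (Tz c * F ^+ b)) = E ^+ 1 * (F * (E ^+ a * (Tz c * F ^+ b))) +
      ((-1) *: (K ^+ 1 * mono a c b) + K ^+ r.-1 * mono a c b).
    by rewrite monoE [in LHS]mulrA F_ES !mulrBl scaleN1r opprB [- _ + _]addrC !mulrA !expr1.
  have abS := pbw_span_base a c b.
  apply: pbw_span_add; first exact: pbw_span_EX.
  by apply: pbw_span_add; [apply: pbw_span_scale|]; apply: pbw_span_KX.
- by rewrite mulrDr; apply: pbw_span_add.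
- by rewrite -scalerAr; apply: pbw_span_scale.
Qed.

Lemma pbw_span_FX (n : nat) (x : U) : pbw_span x -> pbw_span (F ^+ n * x).
Proof.
by move=> xS; elim: n => [|n IHn]; rewrite ?mul1r// exprS -mulrA; apply: pbw_span_F.
Qed.

(** * Values of the left integral on monomials *)

Section LeftIntegral.
Variables (lam : {scalar U}) (lamP : uz_is_left_integral lam).
Local Notation kappa := ((Num.sqrt r%:R : R)%:C).

(** Moving T_c to the right of F^b turns its index into c - b, which is c + 1 modulo r for b = r -
    1. The factor [r - 1]! undoes the divided power. *)
Lemma lam_mono (a b : nat) (c : int) : lam (mono a c b) =
  if (a == r.-1) && (b == r.-1) then qfact R r r.-1 * q ^ (- 2 * (c + 1)) / kappa else 0.
Proof.
have [a_lt|a_ge] := ltnP a r; last first.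
  by rewrite /pbw_mono E_nilp// !mul0r linear0; case: eqP => // a_eq; lia.
have [b_lt|b_ge] := ltnP b r; last first.
  by rewrite /pbw_mono F_nilp// mulr0 linear0 andbC; case: eqP => // b_eq; lia.
have [k k_lt [t kE]] : exists2 k, (k < r)%N & exists t, c - b%:Z = r%:Z * t + k%:Z.
  exists (residue r_gt0 (c - b%:Z)) => //; exists ((c - b%:Z) %/ r%:Z)%Z.
  by rewrite residueE mulrC -divz_eq.
have -> : mono a c b = qfact R r b *: (E ^+ a * uz_Fdiv U b * uz_T U k).
  have FE : F ^+ b = qfact R r b *: uz_Fdiv U b by rewrite scalerA divff ?scale1r ?qfact_neq0.
  rewrite monoE Tz_FX (Tz_congr (t := t) (b := k%:Z)) -?uz_TE; last by rewrite kE addrK.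
  by rewrite FE -scalerAl -scalerAr mulrA.
rewrite linearZ [LHS]/= lamP//; case: ifP => [/andP[_ /eqP b_eq]|_]; last exact: mulr0.
rewrite mulrA -b_eq; congr (_ * _ / _).
rewrite exprnN; apply: (zeta_congr _ r_ge3 r_odd (t := 4 * (t + 1))).
have br : b%:Z = r%:Z - 1 by lia.
have -> : c = r%:Z * t + k%:Z + b%:Z by rewrite -kE subrK.
by rewrite br PoszM; ring.
Qed.

(** Here s counts the factors E to the left of F, and the induction on a moves F across the others.
    The correction terms have degree s + a - 1 < r - 1 in E. *)
Lemma lam_EX_F (a b s : nat) (c : int) : (s + a < r)%N ->
  lam (E ^+ s * F * (E ^+ a * (Tz c * F ^+ b))) = lam (mono (s + a) (c + 1) b.+1).
Proof.
elim: a s => [|a IHa] s sa_lt.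
  by rewrite mul1r -mulrA F_Tz_FX addn0 mulrA.
have -> : E ^+ s * F * (E ^+ a.+1 * (Tz c * F ^+ b)) =
    E ^+ s.+1 * F * (E ^+ a * (Tz c * F ^+ b)) -
    (E ^+ s * (K ^+ 1 * mono a c b) - E ^+ s * (K ^+ r.-1 * mono a c b)).
  rewrite -[LHS]mulrA [F * _]mulrA F_ES monoE (exprSr E s).
  by rewrite !(mulrBl, mulrBr) !mulrA.
have lam0 n : lam (E ^+ s * (K ^+ n * mono a c b)) = 0.
  rewrite KX_mono -scalerAr linearZ /= /pbw_mono !mulrA -exprD -/(mono _ _ _) lam_mono.
  by case: eqP => [?|_]; [lia|rewrite mulr0].
by rewrite !linearB /= !lam0 !oppr0 !addr0 IHa addSnnS.
Qed.

(* Moving F across E only creates terms of lower degree in E, on which lam vanishes. *)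
Lemma lam_mulrF (x : U) : pbw_span x -> lam (x * F) = q ^ 2 * lam (F * x).
Proof.
elim=> [a c b|y z _ yS _ zS|c y _ yS].
- have [a_lt|a_ge] := ltnP a r; last by rewrite /pbw_mono E_nilp// !(mul0r, mulr0) linear0 mulr0.
  have := @lam_EX_F a b 0 c a_lt; rewrite mul1r add0n /pbw_mono !mulrA => ->.
  rewrite -[X in X = _ ]/(lam (E ^+ a * Tz c * F ^+ b * F)) -[_ * F ^+ b * F]mulrA -exprSr.
  rewrite -!/(mono _ _ _) !lam_mono; case: ifP => _; last by rewrite mulr0.
  by rewrite !mulrA [q ^ 2 * _]mulrC -[_ * q ^ 2 * _]mulrA -zetaD//; congr (_ * q ^ _ / _); ring.
- by rewrite mulrDl mulrDr !linearD /= yS zS mulrDr.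
- by rewrite -scalerAl -scalerAr !linearZ /= yS mulrCA.
Qed.

Lemma lam_FX_mono (n a b : nat) (c : int) :
  lam (F ^+ n * mono a c b) = q ^ (- 2 * n%:Z) * lam (mono a c (b + n)).
Proof.
elim: n b => [|n IHn] b; first by rewrite mulr0 expr0z !mul1r addn0.
have FnS := pbw_span_FX n (pbw_span_base a c b).
have monoF : mono a c b * F = mono a c b.+1 by rewrite /pbw_mono -mulrA -exprSr.
(* Multiplying by q^2 prepares the exchange rule for [lam], which sends the leftmost F to the far
   right. *)
apply: (mulfI (expfz_neq0 2 (zeta_neq0 R r_ge3))).
rewrite exprS -mulrA -lam_mulrF// -mulrA monoF IHn addSnnS mulrA -zetaD//.
by congr (q ^ _ * _); rewrite intS; ring.
Qed.

End LeftIntegral.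

End SmallQuantumGroup.

(** * Symmetry and vanishing of Gaussian binomials *)

Section GaussianBinomials.
Variables (R : realType) (r : nat) (r_ge3 : (3 <= r)%N) (r_odd : odd r).
Local Notation q := (zeta R r).

Lemma gbinom_gt (n i : nat) : (n < i)%N -> gbinom R r n i = 0.
Proof. by move=> n_lt; rewrite /gbinom /qbinom leqNgt n_lt mulr0. Qed.

Lemma gbinom_sym (n i : nat) : (i <= n)%N -> gbinom R r n (n - i) = gbinom R r n i.
Proof.
move=> i_le; rewrite /gbinom /qbinom leq_subr i_le subKn// -subzn//.
by rewrite [qfact _ _ i * _]mulrC; congr (q ^ _ * _); ring.
Qed.

(** The added binomials vanish. Giving every expansion the range r makes the ranges independent of
    the degrees. *)
Lemma sum_gbinom_widen (V : lmodType R[i]) (f : nat -> V) (n : nat) : (n < r)%N ->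
  \sum_(i < n.+1) gbinom R r n i *: f i = \sum_(i < r) gbinom R r n i *: f i.
Proof.
move=> n_lt; rewrite (big_ord_widen r (fun i => gbinom R r n i *: f i))//.
rewrite big_mkcond; apply: eq_bigr => i _; rewrite ltnS leqNgt.
by case: ltnP => //= /gbinom_gt ->; rewrite scale0r.
Qed.

End GaussianBinomials.

(** * Coproducts of powers of the generators and of the idempotents *)

Section HopfStructure.
Variables (R : realType) (r : nat) (r_ge3 : (3 <= r)%N) (r_odd : odd r).
Variables (U : uzeta_presentation R r) (UU : tensor_square U).
Local Notation q := (zeta R r).
Local Notation E := (uz_E U).
Local Notation F := (uz_F U).
Local Notation K := (uz_K U).
Local Notation Kinv := (uz_Kinv U).
Local Notation "a ⊗ b" := (ts_pure UU a b) (at level 40).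
Local Notation Tz := (uz_Tz U).

Variables (Delta : {lrmorphism U -> UU}) (DeltaP : uz_is_comul Delta).

Lemma Delta_KX (n : nat) : Delta (K ^+ n) = (K ^+ n) ⊗ (K ^+ n).
Proof. by case: DeltaP => _ _ DK; rewrite rmorphXn /= DK tensorXn. Qed.

Lemma Delta_EX (n : nat) : (n < r)%N ->
  Delta (E ^+ n) = \sum_(i < r) gbinom R r n i *: (E ^+ (n - i) ⊗ (E ^+ i * K ^+ (n - i))).
Proof.
move=> n_lt; case: DeltaP => DE _ _; rewrite rmorphXn /= DE.
rewrite (q_binomial r_ge3 r_odd)//; last first.
  by rewrite !ts_mul mul1r mulr1 (K_E r_ge3) linearZr_LR.
apply: etrans (sum_gbinom_widen (fun i => E ^+ (n - i) ⊗ (E ^+ i * K ^+ (n - i))) n_lt).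
by apply: eq_bigr => i _; rewrite !tensorXn ts_mul expr1n mul1r.
Qed.

Lemma Delta_FX (n : nat) : (n < r)%N ->
  Delta (F ^+ n) = \sum_(k < r) gbinom R r n k *: ((F ^+ (n - k) * Kinv ^+ k) ⊗ (F ^+ k)).
Proof.
move=> n_lt; case: DeltaP => _ DF _; rewrite rmorphXn /= DF.
rewrite (q_binomial r_ge3 r_odd)//; last first.
  rewrite !ts_mul mul1r mulr1 -linearZl_LR; congr (_ ⊗ _).
  have := KX_FX r_ge3 U r.-1 1; rewrite expr1 => ->; congr (_ *: _).
  by apply: (zeta_congr _ r_ge3 r_odd (t := - 4)); lia.
apply: etrans (sum_gbinom_widen (fun k => (F ^+ (n - k) * Kinv ^+ k) ⊗ (F ^+ k)) n_lt).
(* The binomial theorem indexes by the power of F ⊗ 1; after reversal, k counts the factors F in the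
   second tensor factor. *)
rewrite (reindex_inj rev_ord_inj) /=; apply: eq_bigr => k _.
have k_le : (k <= n)%N by rewrite -ltnS ltn_ord.
by rewrite subSS subKn// gbinom_sym// !tensorXn ts_mul expr1n mul1r.
Qed.

(** In K^b ⊗ K^b the second factor is expanded in the T_j; the sum over b then rebuilds T_(m - j) in
    the first. *)
Lemma Delta_Tz (m : int) : Delta (Tz m) = \sum_(j < r) Tz (m - j%:Z) ⊗ Tz j%:Z.
Proof.
rewrite linearZ linear_sum /=.
rewrite (eq_bigr (fun b : 'I_r => \sum_(j < r)
  q ^ (2 * (m - j%:Z) * b%:Z) *: ((K ^+ b) ⊗ Tz j%:Z))); last first.
  move=> b _; rewrite linearZ /= Delta_KX {2}(KX_sum r_ge3 r_odd U (ltn_ord b)).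
  rewrite linear_sumr scaler_sumr; apply: eq_bigr => j _.
  by rewrite linearZr_LR /= scalerA -zetaD//; congr (q ^ _ *: _); ring.
rewrite exchange_big /= scaler_sumr; apply: eq_bigr => j _.
rewrite [X in _ = X ⊗ _]/(uz_Tz _ _) linearZl_LR; congr (_ *: _).
by rewrite linear_sumlz; apply: eq_bigr => b _; rewrite linearZl_LR.
Qed.

End HopfStructure.

(** * Slices of coproducts and left invariance of the integral *)

Section ContractionSwap.
Variables (R : realType) (r : nat) (r_ge3 : (3 <= r)%N) (r_odd : odd r).
Variables (U : uzeta_presentation R r) (UU : tensor_square U).
Local Notation q := (zeta R r).
Local Notation E := (uz_E U).
Local Notation F := (uz_F U).
Local Notation K := (uz_K U).
Local Notation Kinv := (uz_Kinv U).
Local Notation mono := (pbw_mono U).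
Local Notation Tz := (uz_Tz U).

Let r_gt0 : (0 < r)%N. Proof. exact: ltn_trans r_ge3. Qed.

Variables (Delta : {lrmorphism U -> UU}) (DeltaP : uz_is_comul Delta).
Variables (S : {linear U -> U}) (SP : uz_is_antipode S).
Variables (lam : {scalar U}) (lamP : uz_is_left_integral lam).

(** The three coproducts are multiplied out. The power of [q] collects the scalars by which K^(-k)
    in the first factor and K^(l - i) in the second act on monomials. *)
Lemma slice_mono (h : U) (l n : nat) (m : int) : (l < r)%N -> (n < r)%N ->
  ts_lift UU (slice_map lam h) (Delta (mono l m n)) =
  \sum_(i < r) \sum_(j < r) \sum_(k < r)
    (gbinom R r l i * gbinom R r n k *
     q ^ ((l - i)%N%:Z * - (2 * j%:Z) +
          (r.-1 * k)%N%:Z * (2 * (n - k)%N%:Z - 2 * (m - j%:Z))) *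
     lam (h * mono i j%:Z k)) *: mono (l - i) (m - j%:Z) (n - k).
Proof.
move=> l_lt n_lt.
rewrite {1}/pbw_mono 2!(rmorphM Delta) /= (Delta_EX r_ge3 r_odd DeltaP)//.
rewrite (Delta_FX r_ge3 r_odd DeltaP)// (Delta_Tz r_ge3 r_odd DeltaP).
rewrite -mulrA mulr_suml linear_sum; apply: eq_bigr => i _.
rewrite -scalerAl linearZ [LHS]/= mulr_suml mulr_sumr linear_sum scaler_sumr.
apply: eq_bigr => j _.
rewrite !mulr_sumr linear_sum scaler_sumr; apply: eq_bigr => k _.
rewrite -!scalerAr linearZ !ts_mul ts_liftE [LHS]/= /slice_map.
have -> : E ^+ (l - i) * (Tz (m - j%:Z) * (F ^+ (n - k) * Kinv ^+ k)) =
    q ^ ((r.-1 * k)%N%:Z * (2 * (n - k)%N%:Z - 2 * (m - j%:Z))) *: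
    mono (l - i) (m - j%:Z) (n - k).
  by rewrite -(mono_KX r_ge3 r_odd) KinvX /pbw_mono !mulrA.
have -> : E ^+ i * K ^+ (l - i) * (Tz j%:Z * F ^+ k) =
    q ^ ((l - i)%N%:Z * - (2 * j%:Z)) *: mono i j%:Z k.
  rewrite -mulrA [K ^+ _ * _]mulrA (KX_Tz r_ge3 r_odd) -scalerAl -scalerAr monoE.
  by congr (q ^ _ *: _); ring.
rewrite -[h * (q ^ _ *: _)]scalerAr !scalerA zetaD//; congr (_ *: _).
by rewrite [lam (_ *: _)]linearZ /=; ring.
Qed.

(** On monomials [lam] keeps only i = k = r - 1, so both degrees must be r - 1. The first factor is
    then T_(c - j), with a coefficient independent of j, and these idempotents sum to 1. *)
Lemma left_integral (x : U) : pbw_span x ->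
  ts_lift UU (slice_map lam 1) (Delta x) = lam x *: 1.
Proof.
elim=> [a c b|y z _ yS _ zS|d y _ yS].
- have [a_lt|a_ge] := ltnP a r; last first.
    by rewrite /pbw_mono (E_nilp U a_ge) !mul0r !linear0 scale0r.
  have [b_lt|b_ge] := ltnP b r; last first.
    by rewrite /pbw_mono (F_nilp U b_ge) !mulr0 !linear0 scale0r.
  rewrite slice_mono//; have [/andP[/eqP a_eq /eqP b_eq]|ab_ne] :=
      boolP ((a == r.-1) && (b == r.-1)); last first.
    rewrite (lam_mono r_ge3 r_odd lamP) (negbTE ab_ne) scale0r.
    apply: big1 => i _; apply: big1 => j _; apply: big1 => k _.
    rewrite mul1r (lam_mono r_ge3 r_odd lamP); case: ifP => [/andP[/eqP i_eq /eqP k_eq]|_].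
      have [i_gt|i_le] := ltnP a i; first by rewrite gbinom_gt// !mul0r scale0r.
      have [k_gt|k_le] := ltnP b k; first by rewrite (gbinom_gt R _ k_gt) mulr0 !mul0r scale0r.
      by case/nandP: ab_ne => /eqP; lia.
    by rewrite mulr0 scale0r.
  have r1_lt : (r.-1 < r)%N by rewrite prednK.
  rewrite (bigD1 (Ordinal r1_lt)) //= [X in _ + X]big1 ?addr0; last first.
    move=> i /eqP i_ne; apply: big1 => j _; apply: big1 => k _.
    rewrite mul1r (lam_mono r_ge3 r_odd lamP); case: eqP => [i_eq|_].
      by case: i_ne; apply: val_inj.
    by rewrite mulr0 scale0r.
  rewrite -[in RHS](sum_Tz r_ge3 r_odd U) -(sum_periodic_sub r_gt0 (Tz_periodic r_ge3 r_odd U) c).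
  rewrite scaler_sumr; apply: eq_bigr => j _.
  rewrite (bigD1 (Ordinal r1_lt)) //= [X in _ + X]big1 ?addr0; last first.
    move=> k /eqP k_ne; rewrite mul1r (lam_mono r_ge3 r_odd lamP) andbC.
    case: eqP => [k_eq|_]; first by case: k_ne; apply: val_inj.
    by rewrite mulr0 scale0r.
  rewrite mul1r !(lam_mono r_ge3 r_odd lamP) a_eq b_eq !eqxx /= !subnn /pbw_mono mul1r mulr1.
  rewrite !gbinomn//; congr (_ *: _).
  rewrite !mul1r mulrCA !mulrA; congr (_ / _); rewrite -!mulrA; congr (_ * _).
  rewrite -zetaD//; apply: (zeta_congr _ r_ge3 r_odd (t := 4 * (r%:Z - 2) * (j%:Z - c))).
  have -> : (r.-1 * r.-1)%N%:Z = (r%:Z - 1) * (r%:Z - 1) by rewrite PoszM; congr (_ * _); lia.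
  ring.
- by rewrite !linearD /= yS zS scalerDl.
- by rewrite !linearZ /= yS scalerA.
Qed.

(** * The antipode and its exchange with the integral *)

Lemma S_mul (x y : U) : S (x * y) = S y * S x. Proof. by case: SP. Qed.

Lemma S_exp (x : U) (n : nat) : S (x ^+ n) = S x ^+ n.
Proof.
elim: n => [|n IHn]; first by rewrite !expr0; case: SP.
by rewrite exprS S_mul IHn -exprSr.
Qed.

Lemma S_KX (n : nat) : S (K ^+ n) = K ^+ (r.-1 * n).
Proof. by rewrite S_exp -KinvX; case: SP => _ _ _ _ ->. Qed.

Lemma S_Kinv : S Kinv = K.
Proof.
rewrite S_KX; have -> : (r.-1 * r.-1 = r * (r - 2) + 1)%N by nia.
by rewrite exprD exprM K_order expr1n mul1r.
Qed.

Lemma S_FX (n : nat) : S (F ^+ n) = ((-1) ^+ n * q ^ (n%:Z * (n%:Z - 1))) *: (K ^+ n * F ^+ n).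
Proof.
rewrite S_exp; have -> : S F = - (K * F) by case: SP.
elim: n => [|n IHn]; first by rewrite mul0r expr0z !mul1r scale1r.
have FnK : F ^+ n * K = q ^ (2 * n%:Z) *: (K * F ^+ n).
  rewrite -[K in RHS]expr1 (KX_FX r_ge3) expr1 scalerA -zetaD//.
  by rewrite (_ : _ + _ = 0) ?expr0z ?scale1r//; ring.
have -> : K ^+ n.+1 * F ^+ n.+1 = q ^ (- 2 * n%:Z) *: (K ^+ n * F ^+ n * (K * F)).
  rewrite mulrA -[K ^+ n * F ^+ n * K]mulrA FnK -scalerAr -scalerAl scalerA -zetaD//.
  rewrite (_ : _ + _ = 0); last ring.
  by rewrite expr0z scale1r exprSr exprSr !mulrA.
rewrite exprSr IHn mulrN -scalerAl -scaleNr scalerA; congr (_ *: _).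
rewrite exprS -!mulrA -zetaD// mulN1r; congr (- (_ * q ^ _)).
by rewrite intS; ring.
Qed.

(** The antipode inverts K; expanding K^(-n) in the T_j leaves a character sum that selects j = -b
    modulo r. *)
Lemma S_Tz (b : int) : S (Tz b) = Tz (- b).
Proof.
rewrite -[in RHS](sum_periodic_delta r_gt0 (Tz_periodic r_ge3 r_odd U)).
rewrite linearZ linear_sum /=.
rewrite (eq_bigr (fun n : 'I_r => \sum_(j < r)
  q ^ (2 * n%:Z * (b + j%:Z)) *: Tz j%:Z)); last first.
  move=> n _; rewrite linearZ /= S_KX -[K ^+ _]mulr1 -(sum_Tz r_ge3 r_odd U).
  rewrite mulr_sumr scaler_sumr; apply: eq_bigr => j _.
  rewrite (KX_Tz r_ge3 r_odd) scalerA -zetaD//; congr (_ *: _).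
  apply: (zeta_congr _ r_ge3 r_odd (t := - 4 * j%:Z * n%:Z)).
  have r1 : r.-1%:Z = r%:Z - 1 by lia.
  by rewrite PoszM r1; ring.
rewrite exchange_big /= scaler_sumr; apply: eq_bigr => j _.
rewrite -scaler_suml scalerA (sum_zeta _ r_ge3 r_odd) opprK addrC.
by case: ifP => _; rewrite ?mulr0 ?scale0r// mulVf ?scale1r// pnatr_eq0 -lt0n.
Qed.

(* For h = v this trades S(v_(1)) lam(v_(2) x) for x_(1) lam(v x_(2)). *)
Definition contraction_swap (h : U) : Prop := forall x : U, pbw_span x ->
  ts_lift UU (integral_map S lam x) (Delta h) = ts_lift UU (slice_map lam h) (Delta x).

(** For h = 1 the exchange identity is exactly left invariance. *)
Lemma contraction_swap1 : contraction_swap 1.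
Proof.
move=> x xS; rewrite left_integral// rmorph1 -ts_one ts_liftE /= /integral_map mul1r.
by case: SP => ->.
Qed.

Lemma contraction_swap_linear (c : R[i]) (h k : U) :
  contraction_swap h -> contraction_swap k -> contraction_swap (c *: h + k).
Proof. by move=> hS kS x xS; rewrite !linearP /= hS// kS// lift_slice_lin. Qed.

Lemma contraction_swap_sum (n : nat) (c : 'I_n -> R[i]) (h : 'I_n -> U) :
  (forall i, contraction_swap (h i)) -> contraction_swap (\sum_(i < n) c i *: h i).
Proof.
move=> hS; apply: (big_ind contraction_swap) => [|x y xS yS|i _].
(* Zero is obtained as the combination (-1) 1 + 1. *)
- by rewrite -(subrr 1) -scaleN1r addrC; apply: contraction_swap_linear; exact: contraction_swap1.
- by rewrite -[x]scale1r; apply: contraction_swap_linear.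
- rewrite -[X in contraction_swap X]addr0; apply: contraction_swap_linear => //.
  by rewrite -(subrr 1) -scaleN1r addrC; apply: contraction_swap_linear; exact: contraction_swap1.
Qed.

(** The property of h is applied to K x and E x, which stay in the span. The two terms sliced by h K
    then cancel since S(E) K + E = 0, an instance of S(h_(1)) h_(2) = eps(h). *)
Lemma contraction_swap_E (h : U) : contraction_swap h -> contraction_swap (h * E).
Proof.
move=> hS x xS; case: DeltaP => DE _ _; case: SP => S1 _ SE _ _.
have ExS := pbw_span_EX 1 xS; have KxS := pbw_span_KX r_ge3 r_odd 1 xS.
rewrite !expr1 in ExS KxS.
have DEx : ts_lift UU (slice_map lam h) (Delta (E * x)) =
  E * ts_lift UU (slice_map lam (h * K)) (Delta x) + ts_lift UU (slice_map lam (h * E)) (Delta x).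
  by rewrite rmorphM /= DE mulrDl linearD /= !lift_slice_mull mul1r.
have DKx : ts_lift UU (slice_map lam h) (Delta (K * x)) =
  K * ts_lift UU (slice_map lam (h * K)) (Delta x).
  by rewrite rmorphM /=; case: DeltaP => _ _ ->; rewrite lift_slice_mull.
rewrite rmorphM /= DE mulrDr linearD /= !(lift_integral_mulr _ S_mul) !hS// DEx DKx.
by rewrite S1 SE mul1r mulNr !mulrA -[E * Kinv * K]mulrA (KinvK r_ge3) mulr1 addKr.
Qed.

(** Here the cancellation is S(K^-1) F + S(F) = 0, with S(K^-1) = K. *)
Lemma contraction_swap_F (h : U) : contraction_swap h -> contraction_swap (h * F).
Proof.
move=> hS x xS; case: DeltaP => _ DF _; case: SP => S1 _ _ SF _.
have FxS := pbw_span_F r_ge3 r_odd xS.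
have DFx : ts_lift UU (slice_map lam h) (Delta (F * x)) =
  Kinv * ts_lift UU (slice_map lam (h * F)) (Delta x) + F * ts_lift UU (slice_map lam h) (Delta x).
  by rewrite rmorphM /= DF mulrDl linearD /= !lift_slice_mull mulr1.
rewrite rmorphM /= DF mulrDr linearD /= !(lift_integral_mulr _ S_mul) mul1r !hS// DFx.
by rewrite S_Kinv SF mulrDr !mulrA (KKinv r_ge3) mul1r mulNr addrK.
Qed.

Lemma contraction_swap_K (h : U) : contraction_swap h -> contraction_swap (h * K).
Proof.
move=> hS x xS; case: DeltaP => _ _ DK; case: SP => _ _ _ _ SK.
have KxS := pbw_span_KX r_ge3 r_odd 1 xS; rewrite expr1 in KxS.
rewrite rmorphM /= DK (lift_integral_mulr _ S_mul) hS// rmorphM /= DK lift_slice_mull.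
by rewrite SK mulrA (KinvK r_ge3) mul1r.
Qed.

Lemma contraction_swapX (x h : U) (n : nat) :
  (forall k, contraction_swap k -> contraction_swap (k * x)) ->
  contraction_swap h -> contraction_swap (h * x ^+ n).
Proof.
move=> xP hS; elim: n => [|n IHn]; first by rewrite mulr1.
by rewrite exprSr mulrA; apply: xP.
Qed.

Lemma contraction_swap_Tz (h : U) (a : int) : contraction_swap h -> contraction_swap (h * Tz a).
Proof.
move=> hS; rewrite /uz_Tz -scalerAr mulr_sumr scaler_sumr.
rewrite (eq_bigr (fun b : 'I_r => (r%:R^-1 * q ^ (2 * a * b%:Z)) *: (h * K ^+ b))).
  by apply: contraction_swap_sum => b; apply/contraction_swapX/hS; exact: contraction_swap_K.
by move=> b _; rewrite -scalerAr scalerA.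
Qed.

End ContractionSwap.

(** * The ribbon element, its pairing with the integral, and the action on monomials *)

Section RibbonElement.
Variables (R : realType) (r : nat) (r_ge3 : (3 <= r)%N) (r_odd : odd r).
Variables (U : uzeta_presentation R r) (UU : tensor_square U).
Local Notation q := (zeta R r).
Local Notation E := (uz_E U).
Local Notation F := (uz_F U).
Local Notation K := (uz_K U).
Local Notation mono := (pbw_mono U).
Local Notation Tz := (uz_Tz U).
Local Notation kappa := ((Num.sqrt r%:R : R)%:C).

Let r_gt0 : (0 < r)%N. Proof. exact: ltn_trans r_ge3. Qed.

Variables (Delta : {lrmorphism U -> UU}) (DeltaP : uz_is_comul Delta).
Variables (S : {linear U -> U}) (SP : uz_is_antipode S).
Variables (lam : {scalar U}) (lamP : uz_is_left_integral lam).

(** The three exponents come from the R-matrix, from S(F^a), and from T_(-b) absorbing K^(-b), where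
    r - 1 stands for -1. *)
Definition ribbon_coef (a b : nat) : R[i] :=
  q ^ ('C(a, 2)%:Z + a%:Z * (a%:Z - 1) + 2 * b%:Z * (r.-1 * b)%N%:Z) *
  ((-1) ^+ a / qfact R r a).

Definition ribbon_term (a b : nat) : U := K ^+ a * F ^+ a * Tz (- b%:Z) * E ^+ a * K ^+ r.-1.

Lemma ribbonE :
  uz_ribbon UU S = \sum_(a < r) \sum_(b < r) ribbon_coef a b *: ribbon_term a b.
Proof.
rewrite /uz_ribbon /uz_drinfeld /uz_Rmatrix linear_sum mulr_suml; apply: eq_bigr => a _.
rewrite linear_sum mulr_suml; apply: eq_bigr => b _.
rewrite linearZ [LHS]/= ts_liftE [LHS]/= /drinfeld_map (S_mul SP) uz_TE (S_Tz r_ge3 r_odd SP).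
have -> : S (uz_Fdiv U a) =
    ((-1) ^+ a * q ^ (a%:Z * (a%:Z - 1)) / qfact R r a) *: (K ^+ a * F ^+ a).
  by rewrite [S _]linearZ /= (S_FX r_ge3 SP) scalerA mulrC.
have scalerAm c (x y z w : U) : x * (c *: y) * z * w = c *: (x * y * z * w).
  by rewrite -scalerAr -!scalerAl.
set c := _ / qfact R r a.
rewrite KinvX -!scalerAl !scalerA [_ * (_ * E ^+ a)]mulrA.
rewrite -[K ^+ a * F ^+ a * _ * _]mulrA (Tz_KX r_ge3 r_odd) scalerAm scalerA.
congr (_ *: _); rewrite /ribbon_coef /c !zetaD// !exprnP.
have -> : - 2 * - b%:Z * (r.-1 * b)%N%:Z = 2 * b%:Z * (r.-1 * b)%N%:Z by ring.
ring.
Qed.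

(** The ribbon element is a linear combination of products built from 1 by right multiplication by
    generators. *)
Lemma contraction_swap_ribbon : contraction_swap Delta S lam (uz_ribbon UU S).
Proof.
rewrite ribbonE; set v := \sum_(a < r) _.
have -> : v = \sum_(a < r) 1 *: \sum_(b < r) ribbon_coef a b *: ribbon_term a b.
  by apply: eq_bigr => a _; rewrite scale1r.
apply: (contraction_swap_sum r_ge3 r_odd DeltaP SP lamP) => a.
apply: (contraction_swap_sum r_ge3 r_odd DeltaP SP lamP) => b.
have EP h := @contraction_swap_E _ _ r_ge3 r_odd U UU Delta DeltaP S SP lam h.
have FP h := @contraction_swap_F _ _ r_ge3 r_odd U UU Delta DeltaP S SP lam h.
have KP h := @contraction_swap_K _ _ r_ge3 r_odd U UU Delta DeltaP S SP lam h.
do 2!apply: contraction_swapX => //.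
apply: (contraction_swap_Tz r_ge3 r_odd DeltaP SP lamP).
apply: contraction_swapX => //; rewrite -[K ^+ a]mul1r; apply: contraction_swapX => //.
exact: contraction_swap1.
Qed.

(** T_(-b) crosses E^(a + i) and meets T_j, whence the congruence. The exponents come, in order,
    from the last K^(r - 1), from K^a F^a reordered, from K^a on the monomial, and from moving F^a
    to the right under [lam]. *)
Lemma lam_ribbon_term (a b i k : nat) (j : int) :
  lam (ribbon_term a b * mono i j k) =
  if (r%:Z %| b%:Z - (a%:Z + i%:Z - j))%Z then
    q ^ ((r%:Z - 1) * (2 * i%:Z - 2 * j) - 2 * a%:Z * a%:Z +
         a%:Z * (2 * (a%:Z + i%:Z) - 2 * j) - 2 * a%:Z) * lam (mono (a + i) j (k + a))
  else 0.
Proof.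
have r1 : r.-1%:Z = r%:Z - 1 by lia.
rewrite /ribbon_term -[LHS]/(lam _) -mulrA (KX_mono r_ge3 r_odd) -scalerAr linearZ /= r1.
have -> : K ^+ a * F ^+ a * Tz (- b%:Z) * E ^+ a * mono i j k =
    if (r%:Z %| b%:Z - (a%:Z + i%:Z - j))%Z
    then K ^+ a * F ^+ a * mono (a + i) j k else 0.
  have -> : K ^+ a * F ^+ a * Tz (- b%:Z) * E ^+ a * mono i j k =
     K ^+ a * F ^+ a * (Tz (- b%:Z) * E ^+ (a + i) * Tz j * F ^+ k).
    by rewrite /pbw_mono exprD !mulrA.
  rewrite (Tz_EX r_ge3) -[E ^+ (a + i) * _ * _]mulrA (Tz_Tz r_ge3 r_odd).
  have -> : (- b%:Z + (a + i)%N%:Z - j) = - (b%:Z - (a%:Z + i%:Z - j)) by rewrite PoszD; ring.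
  by rewrite rpredN; case: ifP => _; rewrite ?mulr0 ?mul0r ?mulr0.
case: ifP => _; last by rewrite linear0 mulr0.
rewrite (KX_FX r_ge3) -scalerAl -[F ^+ a * K ^+ a * _]mulrA (KX_mono r_ge3 r_odd)
  -scalerAr scalerA linearZ /=.
rewrite (lam_FX_mono r_ge3 r_odd lamP) !mulrA -!zetaD//; congr (q ^ _ * _).
by rewrite PoszD; ring.
Qed.

Lemma kappa_neq0 : kappa != 0.
Proof. by rewrite fmorph_eq0 gt_eqF// sqrtr_gt0 ltr0n. Qed.

Lemma double_bin2 (n : nat) : 2 * 'C(n, 2)%:Z = n%:Z * (n%:Z - 1).
Proof.
elim: n => [|n IHn]; first by rewrite bin0n mulr0 mul0r.
by rewrite binS bin1 PoszD mulrDr IHn intS; ring.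
Qed.

(** The sum over b collapses to b = a + i - j modulo r, and [lam] then leaves only a = r - 1 - i
    with k = i. The quotient [r - 1]! / [a]! is (-1)^a [i]!. *)
Lemma lam_ribbon_mono (i k : nat) (j : int) : (i < r)%N -> (k < r)%N ->
  lam (uz_ribbon UU S * mono i j k) =
  if k == i then
    q ^ (1 - 'C(i, 2)%:Z - 2 * (j + 1) * (j - i%:Z)) * qfact R r i / kappa
  else 0.
Proof.
move=> i_lt k_lt.
have sum_b (a : nat) : lam ((\sum_(b < r) ribbon_coef a b *: ribbon_term a b) * mono i j k) =
    if ((a + i)%N == r.-1) && ((k + a)%N == r.-1) then
    q ^ (1 - 'C(i, 2)%:Z - 2 * (j + 1) * (j - i%:Z)) * qfact R r i / kappa else 0.
  (* The summand as a function of an integer b, since a + i - j may lie outside the range of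
     summation. *)
  pose g (x : int) : R[i] := q ^ ('C(a, 2)%:Z + a%:Z * (a%:Z - 1) + 2 * x * ((r%:Z - 1) * x)) *
    ((-1) ^+ a / qfact R r a) *
    (q ^ ((r%:Z - 1) * (2 * i%:Z - 2 * j) - 2 * a%:Z * a%:Z +
         a%:Z * (2 * (a%:Z + i%:Z) - 2 * j) - 2 * a%:Z) * lam (mono (a + i) j (k + a))).
  have g_per x t : g (x + r%:Z * t) = g x.
    rewrite /g; congr (_ * _ * _).
    by apply: (zeta_congr _ r_ge3 r_odd (t := 4 * (r%:Z - 1) * (2 * x * t + r%:Z * t * t))); ring.
  rewrite mulr_suml linear_sum /=.
  rewrite (eq_bigr (fun b : 'I_r =>
    if (r%:Z %| b%:Z - (a%:Z + i%:Z - j))%Z then g b%:Z else 0)); last first.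
    move=> b _; rewrite -scalerAl linearZ /= lam_ribbon_term.
    case: ifP => _; last exact: mulr0.
    have r1 : r.-1%:Z = r%:Z - 1 by lia.
    by rewrite /ribbon_coef /g PoszM r1.
  rewrite (sum_periodic_delta r_gt0 g_per) /g (lam_mono r_ge3 r_odd lamP).
  case: ifP => [/andP[/eqP ai /eqP ka]|_]; last by rewrite !mulr0.
  have a_lt : (a < r)%N by lia.
  have i_eq : (r.-1 - a = i)%N by lia.
  rewrite (qfact_compl _ r_ge3 r_odd a_lt) i_eq.
  have aZ : a%:Z = r%:Z - 1 - i%:Z by lia.
  have qa := qfact_neq0 R r_ge3 r_odd a_lt.
  have sgn : (-1) ^+ a * (-1) ^+ a = 1 :> R[i] by rewrite -expr2 sqrr_sign.
  set e1 := (X in q ^ X * (_ / _)); set e2 := (X in _ * (q ^ X * _)).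
  have -> : q ^ (1 - 'C(i, 2)%:Z - 2 * (j + 1) * (j - i%:Z)) =
     q ^ e1 * q ^ e2 * q ^ (- 2 * (j + 1)).
    rewrite -!zetaD//.
    have ba := double_bin2 a; have bi := double_bin2 i.
    apply: (zeta_congr _ r_ge3 r_odd (t := 5 - 2 * i%:Z - 4 * (j + 1) * (j + 1) +
      (9 + 8 * j) * r%:Z - 4 * r%:Z * r%:Z)).
    (* On the left these cancel the doubled binomials; on the right they become polynomials, and a =
       r - 1 - i leaves a polynomial identity. *)
    apply: (addIr (2 * 'C(i, 2)%:Z + 2 * 'C(a, 2)%:Z)).
    by rewrite [in RHS]ba [in RHS]bi /e1 /e2 aZ; ring.
  move: (q ^ e1) (q ^ e2) (q ^ (- 2 * (j + 1))) ((-1) ^+ a) sgn => x y z s sgn.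
  transitivity (s * s * (x * y * z * qfact R r i / kappa)).
    by field; rewrite qa kappa_neq0.
  by rewrite sgn mul1r.
rewrite ribbonE mulr_suml linear_sum (eq_bigr _ (fun (a : 'I_r) _ => sum_b a)).
have [k_eq|k_ne] := eqVneq k i; last first.
  by apply: big1 => a _; case: ifP => // /andP[/eqP ? /eqP ?]; case/eqP: k_ne; lia.
have a_lt : (r.-1 - i < r)%N by lia.
rewrite (bigD1 (Ordinal a_lt)) //= k_eq.
have -> : (r.-1 - i + i)%N = r.-1 by lia.
have -> : (i + (r.-1 - i))%N = r.-1 by lia.
rewrite eqxx big1 ?addr0// => a /eqP a_ne; case: ifP => // /andP[/eqP ? _].
by case: a_ne; apply: val_inj => /=; lia.
Qed.

(** After the exchange identity only k = i survives. The prefactor [q] is the constant 1 in the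
    exponent of [lam_ribbon_mono]. *)
Lemma rho_tau_beta_mono (l n : nat) (m : int) : (l < r)%N -> (n < r)%N ->
  rho_tau_beta Delta S lam (mono l m n) =
  (q / kappa) *: \sum_(i < r) \sum_(j < r)
    (gbinom R r l i * gbinom R r n i * qfact R r i *
     q ^ (- (2 * j%:Z) * (l%:Z - i%:Z) - i%:Z * (2 * (n%:Z - i%:Z) - 2 * (m - j%:Z))
          - 'C(i, 2)%:Z - 2 * (j%:Z + 1) * (j%:Z - i%:Z))) *:
    mono (l - i) (m - j%:Z) (n - i).
Proof.
move=> l_lt n_lt.
rewrite /rho_tau_beta contraction_swap_ribbon; last exact: pbw_span_base.
rewrite (slice_mono r_ge3 r_odd DeltaP)// scaler_sumr; apply: eq_bigr => i _.
rewrite scaler_sumr; apply: eq_bigr => j _.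
rewrite (bigD1 i) //= big1 ?addr0 => [|k k_ne]; last first.
  by rewrite lam_ribbon_mono// val_eqE (negbTE k_ne) mulr0 scale0r.
rewrite lam_ribbon_mono// eqxx scalerA; congr (_ *: _).
have [i_gt|i_le] := ltnP l i; first by rewrite gbinom_gt// !mul0r mulr0.
have [i_gt|i_len] := ltnP n i; first by rewrite (gbinom_gt R _ i_gt) !(mulr0, mul0r).
rewrite -!subzn// PoszM.
set e1 := (X in gbinom R r l i * gbinom R r n i * q ^ X).
set e2 := (X in q ^ X * _ / _).
set e3 := (X in _ = _ * (_ * q ^ X)).
have e_eq : q ^ e1 * q ^ e2 = q ^ 1 * q ^ e3.
  rewrite -!zetaD//.
  apply: (zeta_congr _ r_ge3 r_odd (t := 2 * i%:Z * (2 * (n%:Z - i%:Z) - 2 * (m - j%:Z)))).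
  have r1 : r.-1%:Z = r%:Z - 1 by lia.
  by rewrite /e1 /e2 /e3 r1; ring.
transitivity (gbinom R r l i * gbinom R r n i * qfact R r i / kappa * (q ^ e1 * q ^ e2)).
  ring.
by rewrite e_eq expr1z; ring.
Qed.

End RibbonElement.

(** * Divided powers and comparison with the stated sum *)

Theorem lemma5p4 (R : realType) (r : nat) (r_ge3 : (3 <= r)%N) (r_odd : odd r)
    (U : uzeta_presentation R r) (UU : tensor_square U)
    (Delta : {lrmorphism U -> UU}) (S : {linear U -> U}) (lam : {scalar U})
    (DeltaP : uz_is_comul Delta) (SP : uz_is_antipode S)
    (lamP : uz_is_left_integral lam) :
  exists2 c : R[i], c != 0 &
    forall l m n : nat, (l < r)%N -> (m < r)%N -> (n < r)%N ->
      rho_tau_beta Delta S lam (uz_E U ^+ l * uz_T U m * uz_Fdiv U n) =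
        c *: \sum_(i < r) \sum_(j < r)
          (qbinom R r l i *
             zeta R r ^ (- ((i%:Z * (i%:Z - 5)) %/ 2)%Z
                         - 2 * j%:Z * (j%:Z - 1) - 2 * i%:Z * j%:Z
                         + (l%:Z + 2 * m%:Z - n%:Z) * i%:Z + 2 * l%:Z * j%:Z))
          *: (uz_E U ^+ (l - i) * uz_T U (m + j) * uz_Fdiv U (n%:Z - i%:Z)).
Proof.
have r_gt0 : (0 < r)%N by apply: ltn_trans r_ge3.
exists (zeta R r / (Num.sqrt r%:R : R)%:C) => [|l m n l_lt m_lt n_lt].
  by rewrite mulf_neq0 ?invr_eq0 ?kappa_neq0 ?zeta_neq0.
have -> : uz_E U ^+ l * uz_T U m * uz_Fdiv U n = (qfact R r n)^-1 *: pbw_mono U l m%:Z n.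
  by rewrite uz_TE /pbw_mono [RHS]scalerAr.
have rhoZ c x : rho_tau_beta Delta S lam (c *: x) = c *: rho_tau_beta Delta S lam x.
  apply: (tensor_ext (f := ts_lift UU (integral_map S lam (c *: x)))
    (g := fun t => c *: ts_lift UU (integral_map S lam x) t)) => [d u v|d u v|a b].
  - by rewrite linearP.
  - by rewrite linearP scalerDr !scalerA mulrC.
  - by rewrite !ts_liftE /= /integral_map -scalerAr linearZ scalerA.
rewrite rhoZ (rho_tau_beta_mono r_ge3 r_odd DeltaP SP lamP)// scalerA.
rewrite [_ * (zeta R r / _)]mulrC -[LHS]scalerA; congr (_ *: _).
rewrite scaler_sumr; apply: eq_bigr => i _.
(* The stated summand extended to all integers j; being periodic, it allows the substitution j ->
   -j. *)
pose g (j : int) : U := (qbinom R r l i *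
   zeta R r ^ (- ((i%:Z * (i%:Z - 5)) %/ 2)%Z - 2 * j * (j - 1) - 2 * i%:Z * j
               + (l%:Z + 2 * m%:Z - n%:Z) * i%:Z + 2 * l%:Z * j))
   *: (uz_E U ^+ (l - i) * uz_Tz U (m%:Z + j) * uz_Fdiv U (n%:Z - i%:Z)).
have g_per x t : g (x + r%:Z * t) = g x.
  rewrite /g addrA Tz_periodic//; congr (_ * _ *: _).
  apply: (zeta_congr _ r_ge3 r_odd
    (t := - 4 * t * (2 * x + r%:Z * t - 1) - 4 * i%:Z * t + 4 * l%:Z * t)).
  ring.
transitivity (\sum_(j < r) g j%:Z); last first.
  by apply: eq_bigr => j _; rewrite /g uz_TE PoszD.
rewrite -(sum_periodic_sub r_gt0 g_per 0) scaler_sumr; apply: eq_bigr => j _.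
rewrite sub0r /g scalerA.
have [i_gt|i_le] := ltnP l i.
  by rewrite gbinom_gt// /qbinom leqNgt i_gt !(mul0r, mulr0) !scale0r.
(* For i > n the computed term has a zero binomial, and the stated one a divided power of negative
   index. *)
have [i_gt|i_len] := ltnP n i.
  rewrite (gbinom_gt R _ i_gt) !(mul0r, mulr0) scale0r.
  have -> : n%:Z - i%:Z = Negz (i - n).-1 by lia.
  by rewrite mulr0 scaler0.
have -> : uz_E U ^+ (l - i) * uz_Tz U (m%:Z - j%:Z) * uz_Fdiv U (n%:Z - i%:Z) =
    (qfact R r (n - i))^-1 *: pbw_mono U (l - i) (m%:Z - j%:Z) (n - i).
  by rewrite (subzn i_len) /pbw_mono [RHS]scalerAr.
rewrite [RHS]scalerA; congr (_ *: _).
(* The division is exact, because i (i - 5) = 2 (i (i - 1) / 2 - 2 i). *)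
have half : 2 * ((i%:Z * (i%:Z - 5)) %/ 2)%Z = 2 * 'C(i, 2)%:Z - 4 * i%:Z.
  have -> : i%:Z * (i%:Z - 5) = ('C(i, 2)%:Z - 2 * i%:Z) * 2.
    by have := double_bin2 i; lia.
  by rewrite mulzK//; ring.
(* The binomial of n over i, times [i]! from the integral and 1 / [n]! from the divided power,
   leaves 1 / [n - i]!, the normalisation of F^(n - i). *)
rewrite /gbinom [qbinom R r n i]/qbinom i_len.
have qn := qfact_neq0 R r_ge3 r_odd n_lt.
have qi := qfact_neq0 R r_ge3 r_odd (ltn_ord i).
have qni : qfact R r (n - i) != 0.
  by apply: qfact_neq0 => //; exact: leq_ltn_trans (leq_subr _ _) n_lt.
set e1 := (X in zeta R r ^ X * qbinom _ _ _ _ * _).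
set e2 := (X in zeta R r ^ X * (qfact _ _ _ / _)).
set e3 := (X in _ * (_ * zeta R r ^ X) = _).
set e4 := (X in _ = _ * zeta R r ^ X / _).
have -> : zeta R r ^ e4 = zeta R r ^ e1 * zeta R r ^ e2 * zeta R r ^ e3.
  (* The exponents agree as integers; doubling them only serves to remove the halves. *)
  rewrite -!zetaD//; apply: (zeta_congr _ r_ge3 r_odd (t := 0)).
  apply: (addrI (2 * ((i%:Z * (i%:Z - 5)) %/ 2)%Z)).
  by rewrite [in RHS]half /e1 /e2 /e3 /e4; ring.
by field; rewrite qn qi qni.
Qed.
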